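(* There exists a (real) Banach space $X$ satisfying $r(X)=d(X)=1$.
   Context: All Banach spaces are real. $B_X$ is the closed unit ball of $X$ and $S_{X^*}$ the unit sphere of the dual $X^*$. A slice of $B_X$ is a set of the form $S(B_X,x^*,\alpha)=\{x\in B_X: x^*(x)>1-\alpha\}$ with $x^*\in S_{X^*}$ and $\alpha>0$. $B(x,r)$ is the ball of centre $x$ and radius $r$. For a slice $S$ of $B_X$ put $r(S):=\inf\{r>0: S\subseteq B(x,r)\text{ for some }x\in X\}$. Define $r(X):=\inf\{r(S): S\text{ is a slice of }B_X\}$ and $d(X):=\inf\{\operatorname{diam}(S): S\text{ is a slice of }B_X\}$. *)

(* Defs.v *)
From HB Require Import structures.
From mathcomp Require Import all_boot all_order all_algebra.
From mathcomp Require Import all_classical all_reals all_analysis.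

Set Implicit Arguments.
Unset Strict Implicit.
Unset Printing Implicit Defensive.

Import Order.TTheory GRing.Theory Num.Theory.
Import numFieldNormedType.Exports.

Local Open Scope classical_set_scope.
Local Open Scope ring_scope.

Definition unit_ball (R : realType) (X : normedModType R) : set X :=
  closed_ball (0 : X) 1.
Arguments unit_ball {R} X.

(* Extended-real valued, so that a discontinuous functional has norm +oo. *)
Definition dual_norm (R : realType) (X : normedModType R)
    (f : {linear X -> R^o}) : \bar R :=
  ereal_sup [set `|f x|%:E | x in unit_ball X].

Definition dual_sphere (R : realType) (X : normedModType R) :
    set {linear X -> R^o} :=
  [set f : {linear X -> R^o} | continuous f /\ dual_norm f = 1%E].
Arguments dual_sphere {R} X.

Definition slice (R : realType) (X : normedModType R)
    (f : {linear X -> R^o}) (alpha : R) : set X :=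
  [set x | unit_ball X x /\ 1 - alpha < f x].

Definition slices (R : realType) (X : normedModType R) : set (set X) :=
  [set S | exists (f : {linear X -> R^o}) (alpha : R),
    [/\ dual_sphere X f, 0 < alpha & S = slice f alpha]].
Arguments slices {R} X.

Definition diam (R : realType) (X : normedModType R) (S : set X) : \bar R :=
  ereal_sup [set e | exists x y : X, [/\ S x, S y & e = `|x - y|%:E]].

Definition radius (R : realType) (X : normedModType R) (S : set X) : \bar R :=
  ereal_inf [set r%:E | r in
    [set r : R | 0 < r /\ exists x : X, S `<=` ball x r]].

(* When X is the zero space there are no slices, and both infima below
   are +oo. *)
Definition slice_radius (R : realType) (X : normedModType R) : \bar R :=
  ereal_inf [set radius S | S in slices X].

Definition slice_diam (R : realType) (X : normedModType R) : \bar R :=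
  ereal_inf [set diam S | S in slices X].

Arguments slice_radius {R} X.
Arguments slice_diam {R} X.

(* Main.v *)
(** The space is c_0 with the equivalent norm |x| = sup_n max(|x_n|, |x_n - x_0|).
    On the slice x_0 > 1 - e of the unit ball every coordinate lies in [-e, 1],
    because |x_n - x_0| <= 1; hence the slice has diameter at most 1 + 2e.
    Conversely, let x lie in a slice defined by f and let y be any centre.
    Replacing a far coordinate x_n by 1 if x_0 >= 0 and by -1 otherwise keeps x
    in the unit ball.  It also keeps x in the slice for arbitrarily large n,
    since the numbers |f(e_n)| have bounded sums.  As y_n tends to 0, the new
    point is at distance almost 1 from y, so no ball of radius < 1 contains the
    slice. *)

Require Import Defs.
From HB Require Import structures.
From mathcomp Require Import all_boot all_order all_algebra.
From mathcomp Require Import all_classical all_reals all_analysis.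
From mathcomp Require Import lra.

Set Implicit Arguments.
Unset Strict Implicit.
Unset Printing Implicit Defensive.

Import Order.TTheory GRing.Theory Num.Theory.
Import numFieldNormedType.Exports.

Local Open Scope classical_set_scope.
Local Open Scope ring_scope.

(** * The vector space of null sequences *)

Definition null_seq (R : realType) : {pred nat -> R} :=
  [pred x : nat -> R | `[< x @ \oo --> (0 : R) >]].

Lemma null_seqP (R : realType) (x : nat -> R) :
  reflect (forall e, 0 < e -> \forall n \near \oo, `|x n| <= e)
    (x \in @null_seq R).
Proof.
rewrite unfold_in /=; apply: (iffP (asboolP _)) => [/cvgr0Pnorm_le //|h].
exact/cvgr0Pnorm_le.
Qed.

Lemma null_seq_submod_closed (R : realType) : submod_closed (@null_seq R).
Proof.
split; first by rewrite unfold_in /=; apply/asboolP; exact: cvg_cst.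
move=> a x y; rewrite !unfold_in /= => /asboolP hx /asboolP hy; apply/asboolP.
rewrite -[X in _ --> X](addr0 (0 : R)) -[X in _ --> X + _](scaler0 _ a).
by apply: cvgD => //; exact: cvgZl_tmp.
Qed.

HB.instance Definition _ (R : realType) :=
  GRing.isSubmodClosed.Build R (nat -> R) (@null_seq R) (@null_seq_submod_closed R).

Record c0 (R : realType) := C0 { c0_val :> nat -> R ; _ : c0_val \in @null_seq R }.

HB.instance Definition _ (R : realType) := [isSub for @c0_val R].
HB.instance Definition _ (R : realType) := [Choice of c0 R by <:].
HB.instance Definition _ (R : realType) :=
  [SubChoice_isSubLmodule of c0 R by <:].

(** * The norm of the space and its completeness *)

Section C0norm.
Variable R : realType.
Implicit Types (x y : c0 R) (M : R) (n : nat).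

Lemma c0D x y n : (x + y) n = x n + y n.
Proof. by []. Qed.

Lemma c0N x n : (- x) n = - x n.
Proof. by []. Qed.

Lemma c0Z (a : R) x n : (a *: x) n = a * x n.
Proof. by []. Qed.

Lemma c00 n : (0 : c0 R) n = 0.
Proof. by []. Qed.

Lemma c0P x y : (forall n, x n = y n) -> x = y.
Proof. by move=> xy; apply: val_inj; apply: funext. Qed.

Definition c0_norm x : R :=
  sup (range (fun n => Num.max `|x n| `|x n - x 0%N|)).

(** Ensures that the [sup] in [c0_norm] is over a bounded set: the first terms are bounded by the
    sum of their absolute values, the later ones by 1. *)
Lemma c0_bounded x : exists M, forall n, `|x n| <= M.
Proof.
have /null_seqP/(_ 1 ltr01)[N _ hN] := valP x.
exists (1 + \sum_(i < N) `|x i|) => n.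
have [nN|Nn] := ltnP n N.
  rewrite (bigD1 (Ordinal nN)) //= addrCA lerDl addr_ge0 ?sumr_ge0//.
by rewrite (le_trans (hN n Nn)) // lerDl sumr_ge0.
Qed.

Lemma c0_norm_ub x n : Num.max `|x n| `|x n - x 0%N| <= c0_norm x.
Proof.
apply: ub_le_sup; last by exists n.
have [M hM] := c0_bounded x; exists (M + M) => _ [k _ <-].
rewrite ge_max (le_trans (ler_normB _ _)) ?lerD// andbT.
by rewrite (le_trans (hM k)) // lerDl (le_trans _ (hM k)).
Qed.

Lemma c0_norm_le x M : c0_norm x <= M <->
  forall n, `|x n| <= M /\ `|x n - x 0%N| <= M.
Proof.
split=> [xM n|h].
  by apply/andP; rewrite -ge_max (le_trans (c0_norm_ub x n)).
apply: ge_sup; first by exists (Num.max `|x 0%N| `|x 0%N - x 0%N|), 0%N.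
by move=> _ [n _ <-]; rewrite ge_max; apply/andP.
Qed.

Lemma c0_norm_ge0 x : 0 <= c0_norm x.
Proof. by rewrite (le_trans _ (c0_norm_ub x 0)) // le_max normr_ge0. Qed.

Lemma c0_normD x y : c0_norm (x + y) <= c0_norm x + c0_norm y.
Proof.
apply/c0_norm_le => n.
have [/c0_norm_le/(_ n)[x1 x2] /c0_norm_le/(_ n)[y1 y2]] :=
  (lexx (c0_norm x), lexx (c0_norm y)).
by rewrite !c0D opprD addrACA !(le_trans (ler_normD _ _)) ?lerD.
Qed.

Lemma c0_normZ_le (a : R) x : c0_norm (a *: x) <= `|a| * c0_norm x.
Proof.
apply/c0_norm_le => n.
have /c0_norm_le/(_ n)[x1 x2] := lexx (c0_norm x).
by rewrite !c0Z -mulrBr !normrM !ler_wpM2l.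
Qed.

Lemma c0_normZ (a : R) x : c0_norm (a *: x) = `|a| * c0_norm x.
Proof.
apply/eqP; rewrite eq_le c0_normZ_le /=.
have [->|a0] := eqVneq a 0; first by rewrite normr0 mul0r c0_norm_ge0.
(* The reverse inequality is [c0_normZ_le] for the scalar [a^-1] and the vector [a *: x]. *)
rewrite -ler_pdivlMl ?normr_gt0// -normfV.
by rewrite -[leLHS]/(c0_norm x) -{1}[x](scalerK a0) c0_normZ_le.
Qed.

Lemma c0_norm_eq0 x : c0_norm x = 0 -> x = 0.
Proof.
move=> x0; apply: c0P => n.
have /c0_norm_le/(_ n)[xn _] : c0_norm x <= 0 by rewrite x0.
by apply/eqP; rewrite -normr_le0.
Qed.

HB.instance Definition _ :=
  Lmodule_isNormed.Build R (c0 R) c0_normD c0_normZ c0_norm_eq0.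

Lemma norm_le_c0 x M : `|x| <= M <->
  forall n, `|x n| <= M /\ `|x n - x 0%N| <= M.
Proof. exact: c0_norm_le. Qed.

Lemma ler_norm_c0 x n : `|x n| <= `|x|.
Proof. by have /norm_le_c0/(_ n)[] := lexx `|x|. Qed.

(** Coordinates are 1-Lipschitz, so [F] converges coordinatewise. Bounds on balls pass to the limit
    uniformly in the coordinate, so the limit is a null sequence and convergence holds in norm. *)
Lemma c0_complete (F : set_system (c0 R)) :
  ProperFilter F -> cauchy F -> cvg F.
Proof.
move=> FF Fc.
have Fe (e : R) : 0 < e -> exists x, F (ball x e).
  by move=> e0; exact: ((cauchyP F).1 Fc e e0).
have evF n : cvg ((fun x : c0 R => (x n : R)) @ F).
  apply: cauchy_cvg; apply: cauchy_exP => e e0.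
  have [x Fx] := Fe e e0; exists (x n).
  suff : F [set y : c0 R | ball (x n : R) e (y n)] by [].
  apply: filterS Fx => y; rewrite -!ball_normE /=.
  by apply: le_lt_trans; exact: (ler_norm_c0 (x - y) n).
pose l n := lim ((fun x : c0 R => (x n : R)) @ F).
have lx (e : R) x n : F (ball x e) -> `|x n - l n| <= e.
  move=> Fx.
  have h : (fun y : c0 R => `|x n - y n|) @ F --> `|x n - l n|.
    by apply: cvg_norm; apply: cvgB; [exact: cvg_cst|exact: evF].
  rewrite -(cvg_lim _ h)//; apply: limr_le; first exact: cvgP h.
  apply: filterS Fx => y; rewrite -ball_normE /= => /ltW.
  by apply: le_trans; exact: (ler_norm_c0 (x - y) n).
have l0 : l \in @null_seq R.
  apply/null_seqP => e e0.
  have e2 : 0 < e / 2 by rewrite divr_gt0.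
  have [x Fx] := Fe _ e2.
  have /null_seqP/(_ _ e2) := valP x.
  apply: filterS => n xn; rewrite -[l n](subrK (x n)) (splitr e).
  by rewrite (le_trans (ler_normD _ _))// lerD// distrC lx.
pose L : c0 R := C0 l0.
apply/cvg_ex; exists L; apply/cvgrPdist_le => e e0.
have e4 : 0 < e / 4 by rewrite divr_gt0.
have [x Fx] := Fe _ e4; apply: filterS (Fx) => y.
rewrite -ball_normE /= => xy.
(* Coordinates of [L - x] are bounded by [e / 4]; the norm also sees differences of two of them,
   which doubles the bound. *)
have Lx : `|L - x| <= e / 2.
  apply/norm_le_c0 => n; rewrite !c0D !c0N.
  have := lx _ _ n Fx; have := lx _ _ 0%N Fx; rewrite /= !ler_norml.
  by move=> /andP[? ?] /andP[? ?]; split; apply/andP; split; lra.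
rewrite -(subrKA x) (le_trans (ler_normD _ _))//.
by move: xy Lx; lra.
Qed.

HB.instance Definition _ := Uniform_isComplete.Build (c0 R) c0_complete.

End C0norm.

(** * Slices in an arbitrary normed space *)

Lemma in_unit_ball (R : realType) (X : normedModType R) (x : X) :
  unit_ball X x <-> `|x| <= 1.
Proof.
by rewrite /unit_ball closed_ballE// /closed_ball_ /= sub0r normrN.
Qed.

Lemma dual_sphere_le (R : realType) (X : normedModType R)
    (f : {linear X -> R^o}) (x : X) :
  dual_sphere X f -> `|x| <= 1 -> `|f x| <= 1.
Proof.
move=> [_ f1] x1; rewrite -lee_fin -f1.
by apply: ereal_sup_ubound; exists x => //; exact/in_unit_ball.
Qed.

(** As the norm of [f] is the supremum 1, some [x] in the ball has [|f x|] above [1 - a]; then [x]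
    or [- x] lies in the slice. *)
Lemma slice_nonempty (R : realType) (X : normedModType R) (S : set X) :
  slices X S -> S !=set0.
Proof.
move=> [f [a [[fc f1] a0 ->]]].
have [x [x1 fx]] : exists x, unit_ball X x /\ 1 - a < `|f x|.
  apply: contrapT => h.
  have : (dual_norm f <= (1 - a)%:E)%E.
    apply: ge_ereal_sup => _ [x x1 <-]; rewrite lee_fin leNgt.
    by apply/negP => fx; apply: h; exists x.
  by rewrite f1 lee_fin; lra.
have [f0|f0] := leP 0 (f x).
  by exists x; split=> //; rewrite -(ger0_norm f0).
exists (- x); split; first by move: x1; rewrite !in_unit_ball normrN.
by rewrite raddfN -(ltr0_norm f0).
Qed.

(** A ball centred at any point of [S] works; its radius is enlarged by [e] because balls are open
    and radii positive. *)
Lemma radius_le_diam (R : realType) (X : normedModType R) (S : set X) :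
  S !=set0 -> (Defs.radius S <= diam S)%E.
Proof.
move=> [x Sx]; have d0 : (0 <= diam S)%E.
  by apply: ereal_sup_ubound; exists x, x; rewrite subrr normr0.
apply/lee_addgt0Pr => e e0.
move Ed : (diam S) d0 => [d| |] // d0; last by rewrite addye// leey.
apply: ereal_inf_lbound; exists (d + e) => //; split.
  by rewrite ltr_wpDl.
exists x => y Sy; rewrite -ball_normE /= (@le_lt_trans _ _ d) ?ltrDl//.
by rewrite -lee_fin -Ed; apply: ereal_sup_ubound; exists x, y.
Qed.

Lemma slice_radius_le_diam (R : realType) (X : normedModType R) :
  (slice_radius X <= slice_diam X)%E.
Proof.
apply: le_ereal_inf_tmp => _ [S XS <-].
apply: le_trans (radius_le_diam (slice_nonempty XS)).
by apply: ereal_inf_lbound; exists S.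
Qed.

(** * Slices of the renormed space *)

Section C0slices.
Variable R : realType.
Implicit Types (x y : c0 R) (n : nat).

Lemma c0_basis_subproof n : (fun k => (k == n)%:R) \in @null_seq R.
Proof.
apply/null_seqP => e e0; exists n.+1 => // k /= nk.
by rewrite gtn_eqF// normr0 ltW.
Qed.

Definition c0_basis n : c0 R := C0 (c0_basis_subproof n).

(** Overwriting a coordinate by adding a multiple of a basis vector makes the effect on a linear
    functional explicit. *)
Lemma c0_update x n (a : R) k :
  (x + (a - x n) *: c0_basis n) k = if k == n then a else x k.
Proof.
rewrite c0D c0Z /=; have [->|_] := eqVneq k n; last by rewrite mulr0 addr0.
by rewrite mulr1 addrC subrK.
Qed.

(** Otherwise a signed sum of [m] far basis vectors has norm at most 1 while [f] is at least [m * e]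
    there, which is absurd once [m > 1 / e]. *)
Lemma dual_basis_small (f : {linear c0 R -> R^o}) (e : R) N :
  (forall x, `|x| <= 1 -> `|f x| <= 1) -> 0 < e ->
  exists2 n, (N <= n)%N & `|f (c0_basis n)| < e.
Proof.
move=> f1 e0; apply: contrapT => h.
(* With indices strictly above [N], the vectors built below vanish at coordinate 0, so their norm is
   the sup norm. *)
have fe n : (N < n)%N -> e <= `|f (c0_basis n)|.
  move=> Nn; rewrite leNgt; apply/negP => fn; apply: h; exists n => //.
  exact: ltnW.
have step m : exists x, [/\ forall k, `|x k| <= 1,
    forall k, (k <= N)%N || (N + m < k)%N -> x k = 0 & e *+ m <= f x].
  elim: m => [|m [x [x1 x0 fx]]].
    by exists 0; split=> [k|k _|]; rewrite ?c00 ?normr0 ?linear0.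
  (* Adding sg(f(e_n)) e_n at a fresh coordinate n keeps the norm <= 1 while f
     gains |f(e_n)| >= e. *)
  pose n := (N + m).+1; pose s : R := Num.sg (f (c0_basis n)).
  have xn : x n = 0 by apply: x0; rewrite /n ltnSn orbT.
  exists (x + (s - x n) *: c0_basis n); split.
  - move=> k; rewrite c0_update; case: ifP => // _.
    by rewrite /s normr_sg; case: eqP.
  - move=> k kN; rewrite c0_update; case: eqP => [kn|_].
      by move: kN; rewrite kn /n addnS ltnn orbF leqNgt ltnS leq_addr.
    by apply: x0; case/orP: kN => [->//|]; rewrite addnS => /ltnW ->; rewrite orbT.
  - rewrite linearD linearZ /= xn subr0 mulrSr lerD//.
    rewrite /s -[leRHS]/(Num.sg (f (c0_basis n)) * f (c0_basis n)).
    rewrite -normrEsg fe// /n ltnS leq_addr//.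
have [x [x1 x0 fx]] := step (Num.bound e^-1).
have : `|x| <= 1.
  by apply/norm_le_c0 => k; rewrite (x0 0%N)// subr0.
move=> /f1 /ler_normlP[_] /(le_trans fx).
rewrite -mulr_natr -ler_pdivlMl// mulr1 leNgt.
by rewrite archi_boundP// invr_ge0 ltW.
Qed.

Lemma c0_slice_radius_ge1 : (1 <= slice_radius (c0 R))%E.
Proof.
apply: le_ereal_inf_tmp => _ [S XS <-].
apply: le_ereal_inf_tmp => _ [r [_ [y Sy]] <-]; rewrite lee_fin.
apply/ler_addgt0Pr => e e0.
have [x] := slice_nonempty XS.
case: XS => f [a [f1 a0 ES]]; rewrite ES => -[/in_unit_ball x1 fx].
have x0 : `|x 0%N| <= 1 by rewrite (le_trans (ler_norm_c0 _ _)).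
pose d : R := f x - (1 - a).
have d0 : 0 < d by rewrite subr_gt0.
have /null_seqP/(_ e e0)[N _ yN] := valP y.
(* The bound 1 keeps [n] away from coordinate 0. Changing [x n] to [s] moves it by at most 2, so [f]
   changes by less than the slack [d]. *)
have [||n Nn fn] := @dual_basis_small f (d / 2) (maxn N 1).
- by move=> z; exact: dual_sphere_le.
- by rewrite divr_gt0.
move: Nn; rewrite geq_max => /andP[/yN /= yn n0].
(* Sharing the sign of [x 0] gives [|s - x 0| <= 1], as the norm requires. *)
pose s : R := if 0 <= x 0%N then 1 else -1.
have s1 : `|s| = 1 by rewrite /s; case: ifP => _; rewrite ?normrN normr1.
pose z := x + (s - x n) *: c0_basis n.
have zE k : z k = if k == n then s else x k by exact: c0_update.
have z0 : z 0%N = x 0%N by rewrite zE ltn_eqF.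
have /Sy : S z.
  rewrite ES; split.
    apply/in_unit_ball/norm_le_c0 => k; rewrite z0 zE; case: ifP => _.
      split; first by rewrite s1.
      move: x0; rewrite /s !ler_norml; case: ifP => [|/negbT];
        rewrite -?ltNge => ? /andP[? ?]; apply/andP; split; lra.
    by have /norm_le_c0/(_ k) := x1.
  have -> : f z = f x + (s - x n) * f (c0_basis n) by rewrite linearD linearZ.
  have xn : `|s - x n| <= 2.
    rewrite (le_trans (ler_normB _ _))// s1 (_ : 2 = 1 + 1)// lerD2l.
    by rewrite (le_trans (ler_norm_c0 _ _)).
  have : `|(s - x n) * f (c0_basis n)| < d.
    rewrite normrM (@le_lt_trans _ _ (2 * `|f (c0_basis n)|))// ?ler_wpM2r//.
    by rewrite mulrC -ltr_pdivlMr.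
  by rewrite ltr_norml /d; lra.
rewrite -ball_normE /= => /ltW yz.
have := le_trans (ler_norm_c0 (y - z) n) yz.
rewrite c0D c0N zE eqxx distrC => sy.
(* Here [1 = |s| <= |s - y n| + |y n| <= r + e]. *)
rewrite -s1 -[s](subrK (y n)) (le_trans (ler_normD _ _))// lerD//.
Qed.

Definition c0_first (x : c0 R) : R^o := x 0%N.

Lemma c0_first_linear : linear c0_first.
Proof. by []. Qed.

HB.instance Definition _ :=
  GRing.isLinear.Build R (c0 R) R^o *:%R c0_first c0_first_linear.

Lemma c0_first_sphere : dual_sphere (c0 R) c0_first.
Proof.
split.
  apply: bounded_linear_continuous; apply/bounded_funP => r; exists r => x.
  by apply: le_trans; exact: ler_norm_c0.
apply/eqP; rewrite eq_le; apply/andP; split.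
  apply: ge_ereal_sup => _ [x /in_unit_ball x1 <-]; rewrite lee_fin.
  by apply: le_trans x1; exact: ler_norm_c0.
apply: ereal_sup_ubound; exists (c0_basis 0); last by rewrite /c0_first /= normr1.
apply/in_unit_ball/norm_le_c0 => -[|n] /=.
  by rewrite subrr normr0 normr1.
by rewrite sub0r normrN normr1 normr0.
Qed.

Lemma c0_slice_diam_le1 : (slice_diam (c0 R) <= 1)%E.
Proof.
apply/lee_addgt0Pr => e e0.
have e2 : 0 < e / 2 by rewrite divr_gt0.
apply: (@le_trans _ _ (diam (slice c0_first (e / 2)))).
  apply: ereal_inf_lbound; exists (slice c0_first (e / 2)) => //.
  by exists c0_first, (e / 2); split=> //; exact: c0_first_sphere.
apply: ge_ereal_sup => _ [x [y [[/in_unit_ball x1 fx] [/in_unit_ball y1 fy] ->]]].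
rewrite lee_fin; apply/norm_le_c0 => n; rewrite !c0D !c0N.
have {}fx : (1 - e / 2 : R) < x 0%N := fx.
have {}fy : (1 - e / 2 : R) < y 0%N := fy.
move: x1 => /norm_le_c0 x1; move: y1 => /norm_le_c0 y1.
(* For both points the coordinate [n] lies in [[- e / 2, 1]], and its difference with coordinate 0
   in [[-1, e / 2]]. Both intervals have length [1 + e / 2]. *)
move: (x1 n) (x1 0%N) (y1 n) (y1 0%N); rewrite !ler_norml.
move=> [/andP[? ?] /andP[? ?]] [/andP[? ?] _] [/andP[? ?] /andP[? ?]] [/andP[? ?] _].
by split; apply/andP; split; lra.
Qed.

End C0slices.

Theorem theorem1p1 (R : realType) :
  exists X : completeNormedModType R,
    slice_radius X = 1%E /\ slice_diam X = 1%E.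
Proof.
exists (c0 R).
have r1 := c0_slice_radius_ge1 R; have d1 := c0_slice_diam_le1 R.
have rd := slice_radius_le_diam (c0 R).
(* The chain [1 <= r(X) <= d(X) <= 1] collapses. *)
by split; apply/eqP; rewrite eq_le ?r1 ?d1 ?(le_trans rd) ?(le_trans r1).
Qed.
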